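(* Let $p(z)=\sum_{j=0}^{n}a_jz^j$ be a polynomial of degree $n$ with complex coefficients, and let $K\ge 1$. If $p(z)\neq 0$ for all $|z|<K$, then for all $0<r<R\le 1$, $$M(p,r)\ \ge\ \frac{(1+r)^n}{(1+r)^n+(R+K)^n-(r+K)^n}\left[M(p,R)+n\,m\,\ln\!\left(\frac{R+K}{r+K}\right)\right],$$ where $m=\min_{|z|=K}|p(z)|$.
   Context: For a complex polynomial $p$ and $r>0$, $M(p,r):=\max_{|z|=r}|p(z)|$. *)

(* Defs.v *)
From HB Require Import structures.
From mathcomp Require Import all_boot all_order all_algebra.
From mathcomp Require Import complex.
From mathcomp Require Import all_classical all_reals all_analysis.

Set Implicit Arguments.
Unset Strict Implicit.
Unset Printing Implicit Defensive.

Import Order.TTheory GRing.Theory Num.Theory.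
Import numFieldNormedType.Exports.

Local Open Scope classical_set_scope.
Local Open Scope ring_scope.

(* [`|z|] takes values in [R[i]]; [cmod z] is the same modulus as an element
   of [R] (see [cmodE]). *)
Definition cmod (R : realType) (z : R[i]) : R := ComplexField.Normc.normc z.

Definition moduli_on_circle (R : realType) (p : {poly R[i]}) (r : R) : set R :=
  [set cmod p.[z] | z in [set z : R[i] | cmod z = r]].

(* For [0 <= r] the supremum and the infimum are attained, so they are the
   maximum and the minimum over the circle: see [maxmodP] and [minmodP]. *)
Definition maxmod (R : realType) (p : {poly R[i]}) (r : R) : R :=
  sup (moduli_on_circle p r).

Definition minmod (R : realType) (p : {poly R[i]}) (r : R) : R :=
  inf (moduli_on_circle p r).

Lemma cmodE (R : realType) (z : R[i]) : `|z| = (cmod z)%:C%C.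
Proof. by []. Qed.

Section Attained.
Variable R : realType.
Implicit Types (p : {poly R[i]}) (r : R).

Let mk (x : R * R) : R[i] := (x.1 +i* x.2)%C.

Let horner_cont p :
  continuous (fun x : R * R => complex.Re p.[mk x]) /\
  continuous (fun x : R * R => complex.Im p.[mk x]).
Proof.
elim/poly_ind: p => [|p c [cRe cIm]].
  by split=> x; under eq_fun do rewrite horner0 /=; exact: cvg_cst.
have E (x : R * R) : p.[mk x] =
    (complex.Re p.[mk x] +i* complex.Im p.[mk x])%C by case: p.[mk x].
have c1 : continuous (fun x : R * R => x.1) by move=> x; exact: cvg_fst.
have c2 : continuous (fun x : R * R => x.2) by move=> x; exact: cvg_snd.
split=> x.
- rewrite (_ : (fun y : R * R => _) = fun y : R * R =>
    complex.Re p.[mk y] * y.1 - complex.Im p.[mk y] * y.2 + complex.Re c).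
    apply: cvgD; last exact: cvg_cst.
    by apply: cvgB; apply: cvgM; (exact: cRe || exact: cIm || exact: c1
      || exact: c2).
  by apply/funext => y; rewrite hornerMXaddC E; case: (c).
- rewrite (_ : (fun y : R * R => _) = fun y : R * R =>
    complex.Re p.[mk y] * y.2 + complex.Im p.[mk y] * y.1 + complex.Im c).
    apply: cvgD; last exact: cvg_cst.
    by apply: cvgD; apply: cvgM; (exact: cRe || exact: cIm || exact: c1
      || exact: c2).
  by apply/funext => y; rewrite hornerMXaddC E; case: (c).
Qed.

Let cmod_cont p : continuous (fun x : R * R => cmod p.[mk x]).
Proof.
move=> x; have [cRe cIm] := horner_cont p.
have c : continuous (fun y : R * R =>
    complex.Re p.[mk y] * complex.Re p.[mk y] +
    complex.Im p.[mk y] * complex.Im p.[mk y]).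
  by move=> y; apply: cvgD; apply: cvgM; (exact: cRe || exact: cIm).
rewrite (_ : (fun y : R * R => _) = fun y : R * R =>
  Num.sqrt (complex.Re p.[mk y] * complex.Re p.[mk y] +
    complex.Im p.[mk y] * complex.Im p.[mk y])).
  by apply: (continuous_comp (c x)); exact: sqrt_continuous.
by apply/funext => y; rewrite /cmod -!expr2; case: p.[mk y].
Qed.

Let circle r : set (R * R) := [set x | cmod (mk x) = r].

Let circle_compact r : compact (circle r).
Proof.
apply: (@subclosed_compact _ _ (`[- r, r] `*` `[- r, r])).
- rewrite (_ : circle r = (fun x => cmod 'X.[mk x]) @^-1` [set r]).
    by apply: closed_comp => // x _; exact: cmod_cont.
  by apply/seteqP; split=> x /=; rewrite hornerX.
- by apply: compact_setX; exact: segment_compact.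
- move=> [x y] /= <-; rewrite /cmod /mk /= !in_itv /= -!ler_norml.
  by split; rewrite -sqrtr_sqr ler_sqrt ?addr_ge0 ?sqr_ge0//
    ?lerDl ?lerDr sqr_ge0.
Qed.

Let circle_neq0 r : 0 <= r -> circle r !=set0.
Proof.
by move=> r0; exists (r, 0); rewrite /circle /cmod /= expr0n addr0 sqrtr_sqr
  ger0_norm.
Qed.

Lemma maxmodP p r : 0 <= r ->
  (exists2 z : R[i], cmod z = r & cmod p.[z] = maxmod p r) /\
  (forall z : R[i], cmod z = r -> cmod p.[z] <= maxmod p r).
Proof.
move=> r0.
have [c /set_mem cr cmax] := compact_EVT_max (circle_neq0 r0)
  (@circle_compact r) (continuous_subspaceT (@cmod_cont p)).
have ub : ubound (moduli_on_circle p r) (cmod p.[mk c]).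
  by move=> _ [[x y] /= xy <-]; exact: (cmax (x, y) (mem_set xy)).
have mc : moduli_on_circle p r (cmod p.[mk c]) by exists (mk c).
have -> : maxmod p r = cmod p.[mk c].
  apply/eqP; rewrite eq_le; apply/andP; split.
    by apply: ge_sup => //; exists (cmod p.[mk c]).
  by apply: ub_le_sup => //; exists (cmod p.[mk c]).
by split=> [|z zr]; [exists (mk c) | apply: ub; exists z].
Qed.

Lemma minmodP p r : 0 <= r ->
  (exists2 z : R[i], cmod z = r & cmod p.[z] = minmod p r) /\
  (forall z : R[i], cmod z = r -> minmod p r <= cmod p.[z]).
Proof.
move=> r0.
have [c /set_mem cr cmin] := compact_EVT_min (circle_neq0 r0)
  (@circle_compact r) (continuous_subspaceT (@cmod_cont p)).
have lb : lbound (moduli_on_circle p r) (cmod p.[mk c]).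
  by move=> _ [[x y] /= xy <-]; exact: (cmin (x, y) (mem_set xy)).
have mc : moduli_on_circle p r (cmod p.[mk c]) by exists (mk c).
have -> : minmod p r = cmod p.[mk c].
  apply/eqP; rewrite eq_le; apply/andP; split.
    by apply: ge_inf => //; exists (cmod p.[mk c]).
  by apply: lb_le_inf => //; exists (cmod p.[mk c]).
by split=> [|z zr]; [exists (mk c) | apply: lb; exists z].
Qed.

End Attained.

(* Main.v *)
Require Import Defs.
From HB Require Import structures.
From mathcomp Require Import all_boot all_order all_algebra.
From mathcomp Require Import complex.
From mathcomp Require Import all_classical all_reals all_analysis.
From mathcomp Require Import ring lra.

Import Order.TTheory GRing.Theory Num.Theory.
Import numFieldNormedType.Exports.

Local Open Scope ring_scope.

(* Put x = (R + K) / (r + K).  Each linear factor of a polynomial q of degree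
   at most n without zeros in |z| < K grows by at most the factor x from r u to
   R u, so |q(R u)| <= x^n |q(r u)| for |u| = 1.  By the minimum principle this
   applies to q = p - w for every |w| < m; choosing u where |p| is maximal on
   |z| = R, the argument of w as that of p(r u), and letting |w| tend to m gives
   M(p,R) - m <= x^n (M(p,r) - m).  Since x^n - 1 >= n ln x, this yields
   M(p,R) + n m ln x <= x^n M(p,r), and K >= 1 makes the stated constant at most
   x^-n. *)

(* Near [z], [p] behaves like [p.[z] + b h ^+ k]; take [h] a small positive
   multiple of a [k]-th root of [- p.[z] / b]. *)
Lemma poly_descent (C : numClosedFieldType) (p : {poly C}) (z e : C) :
  (1 < size p)%N -> p.[z] != 0 -> 0 < e ->
  exists2 h, `|h| < e & `|p.[z + h]| < `|p.[z]|.
Proof.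
move=> sp az e0; set a := p.[z] in az *.
have [k [s sz pE]] := multiplicity_XsubC (p - a%:P) z.
have pa0 : p - a%:P != 0.
  apply: contraTneq sp => /eqP; rewrite subr_eq0 => /eqP ->.
  by rewrite size_polyC az.
move: sz; rewrite pa0 /= => sz.
have k0 : (0 < k)%N.
  rewrite lt0n; apply: contraNneq sz => k0.
  by move: pE; rewrite k0 mulr1 => <-; rewrite /root hornerD hornerN hornerC subrr.
have /factor_theorem [g gE] : root (s - s.[z]%:P) z.
  by rewrite /root hornerD hornerN hornerC subrr.
rewrite /root in sz; set b := s.[z] in sz gE *.
pose u := k.-root (- a / b).
have uk : u ^+ k = - a / b by rewrite rootCK.
(* [B] bounds [g] on a disc that contains every [z + t * u] with [0 <= t <= 1]. *)
have [B Bub] := poly_disk_bound g (`|z| + `|u|).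
have B0 : 0 <= B by apply: le_trans (Bub z _); rewrite ?lerDl.
pose X := B * `|u| / `|b|.
have X0 : 0 <= X by rewrite !mulr_ge0 ?invr_ge0.
have Y0 : 0 <= `|u| / e by rewrite divr_ge0 // ltW.
(* The three summands of [D] give [t <= 1], [t * |u| < e] and [t * X < 1] at once. *)
pose D := 1 + `|u| / e + X; pose t := D^-1.
have D0 : 0 < D by rewrite /D ltr_wpDr // ltr_pwDl.
have t0 : 0 < t by rewrite invr_gt0.
have t1 : t <= 1 by rewrite invf_le1 // /D -addrA lerDl addr_ge0.
have tX : t * X < 1.
  by rewrite /t mulrC ltr_pdivrMr // mul1r /D ltrDr ltr_wpDr.
have tu : t * `|u| < e.
  rewrite /t mulrC ltr_pdivrMr // -ltr_pdivrMl // mulrC /D.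
  by rewrite addrAC ltrDr ltr_wpDr.
exists (t * u); first by rewrite normrM gtr0_norm.
have tk0 : 0 < t ^+ k by rewrite exprn_gt0.
have tk1 : t ^+ k <= 1 by rewrite exprn_ile1 // ltW.
have sE x : s.[x] = b + g.[x] * (x - z).
  move/(congr1 (fun q => q.[x])): gE; rewrite !hornerE => /eqP.
  by rewrite subr_eq addrC => /eqP.
have pzE x : p.[x] = a + s.[x] * (x - z) ^+ k.
  move/(congr1 (fun q => q.[x])): pE; rewrite !hornerE => /eqP.
  by rewrite subr_eq addrC => /eqP.
(* The choice of [u] turns [b * (t * u) ^+ k] into [- a * t ^+ k]. The modulus gains [t ^+ k * |a|],
   and the remainder is at most [t * X] times that gain. *)
have -> : p.[z + t * u] =
    a * (1 - t ^+ k) - g.[z + t * u] * (t * u) * (t ^+ k * a / b).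
  rewrite pzE sE; have -> : z + t * u - z = t * u by ring.
  by rewrite exprMn uk; field.
apply: le_lt_trans (ler_normB _ _) _.
rewrite normrM [`|1 - _|]ger0_norm ?subr_ge0 //.
rewrite -ltrBrDl.
have -> : `|a| - `|a| * (1 - t ^+ k) = t ^+ k * `|a| by ring.
rewrite !normrM [`|t ^+ k|]gtr0_norm // [`|t|]gtr0_norm // normfV.
have gB : `|g.[z + t * u]| <= B.
  apply: Bub; apply: le_trans (ler_normD _ _) _; rewrite lerD2l normrM gtr0_norm //.
  by rewrite ler_piMl.
apply: (@le_lt_trans _ _ (t * X * (t ^+ k * `|a|))).
  have -> : t * X * (t ^+ k * `|a|) = B * (t * `|u|) * (t ^+ k * `|a| / `|b|).
    by rewrite /X; ring.
  by rewrite ler_wpM2r ?ler_wpM2r // ?mulr_ge0 ?invr_ge0 // ltW.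
by rewrite gtr_pMl // mulr_gt0 // normr_gt0.
Qed.

(** * Moduli of polynomials: minimum principle and radial growth *)

Section Modulus.
Variable F : realType.
Implicit Types (p : {poly F[i]}) (z w : F[i]).

Lemma cmod_ge0 z : 0 <= cmod z.
Proof. by have := normr_ge0 z; rewrite cmodE lecR. Qed.

Lemma cmodM z w : cmod (z * w) = cmod z * cmod w.
Proof. exact: ComplexField.Normc.normcM. Qed.

Lemma cmod_real (x : F) : cmod x%:C%C = `|x|.
Proof. by rewrite /cmod /= expr0n addr0 sqrtr_sqr. Qed.

Lemma ler_cmodB z w : cmod (z - w) >= cmod z - cmod w.
Proof. by have := lerB_dist z w; rewrite !cmodE -rmorphB lecR. Qed.

Lemma ler_cmodD z w : cmod (z + w) <= cmod z + cmod w.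
Proof. by have := ler_normD z w; rewrite !cmodE -rmorphD lecR. Qed.

Let ReMD z w c : complex.Re (z * w + c) =
  complex.Re z * complex.Re w - complex.Im z * complex.Im w + complex.Re c.
Proof. by case: z w c => [? ?] [? ?] []. Qed.

Let ImMD z w c : complex.Im (z * w + c) =
  complex.Re z * complex.Im w + complex.Im z * complex.Re w + complex.Im c.
Proof. by case: z w c => [? ?] [? ?] []. Qed.

Let mk (x : F * F) : F[i] := (x.1 +i* x.2)%C.

(** Horner's scheme, by induction on [p], separately for the real and imaginary parts. Points are
    pairs of reals so that compactness of boxes applies. *)
Lemma continuous_cmod_horner p : continuous (fun x : F * F => cmod p.[mk x]).
Proof.
have c1 : continuous (fun x : F * F => x.1) by move=> x; exact: cvg_fst.
have c2 : continuous (fun x : F * F => x.2) by move=> x; exact: cvg_snd.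
have [cRe cIm] : continuous (fun x : F * F => complex.Re p.[mk x]) /\
    continuous (fun x : F * F => complex.Im p.[mk x]).
  elim/poly_ind: p => [|p c [cRe cIm]].
    by split=> x; under eq_fun do rewrite horner0 /=; exact: cvg_cst.
  split=> x; under eq_fun do rewrite hornerMXaddC ?ReMD ?ImMD /=.
  - apply: cvgD; last exact: cvg_cst.
    by apply: cvgB; apply: cvgM; [exact: cRe|exact: c1|exact: cIm|exact: c2].
  - apply: cvgD; last exact: cvg_cst.
    by apply: cvgD; apply: cvgM; [exact: cRe|exact: c2|exact: cIm|exact: c1].
move=> x.
rewrite (_ : (fun y => _) = fun y => Num.sqrt
    (complex.Re p.[mk y] * complex.Re p.[mk y] +
     complex.Im p.[mk y] * complex.Im p.[mk y])); last first.
  by apply/funext => y; rewrite /cmod -!expr2; case: p.[mk y].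
apply: continuous_comp; last exact: sqrt_continuous.
by apply: cvgD; apply: cvgM; (exact: cRe || exact: cIm).
Qed.

(* An interior minimum of [|p|] over the closed disc is excluded by
   [poly_descent], so the minimum is taken on the boundary circle. *)
Lemma minmod_principle p (K : F) z :
  (forall w, cmod w < K -> p.[w] != 0) -> cmod z <= K ->
  minmod p K <= cmod p.[z].
Proof.
move=> p0 zK; have K0 : 0 <= K := le_trans (cmod_ge0 z) zK.
have [_ mmin] := minmodP p K0.
(* A constant takes its value on the circle as well; the descent needs positive degree. *)
have [sp|sp] := leqP (size p) 1.
  have pz w : p.[w] = p`_0 by rewrite (size1_polyC sp) hornerC coefC.
  by rewrite pz -(pz K%:C%C) mmin // cmod_real ger0_norm.
pose D := [set x : F * F | cmod (mk x) <= K]%classic.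
have cD : compact D.
  apply: (@subclosed_compact _ _ (`[- K, K] `*` `[- K, K])%classic).
  - rewrite (_ : D = (fun x => cmod 'X.[mk x]) @^-1` [set y | y <= K])%classic.
      apply: preimage_closed; last exact: closed_le.
      by move=> x _; exact: continuous_cmod_horner.
    by apply/seteqP; split=> x /=; rewrite hornerX.
  - by apply: compact_setX; exact: segment_compact.
  - move=> [x y] /= xyK.
    have h (a b : F) : a ^+ 2 + b ^+ 2 <= K ^+ 2 -> - K <= a <= K.
      move=> abK; rewrite -ler_norml -ler_sqr ?nnegrE // real_normK ?num_real //.
      by rewrite (le_trans _ abK) // lerDl sqr_ge0.
    have xyK2 : x ^+ 2 + y ^+ 2 <= K ^+ 2.
      by rewrite -(@ler_sqrt _ _ (K ^+ 2)) ?exprn_ge0 // sqrtr_sqr ger0_norm.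
    rewrite !in_itv /=; split; first exact: h xyK2.
    by apply: (h y x); rewrite addrC.
have D0 : (D !=set0)%classic by exists (complex.Re z, complex.Im z); case: z zK.
have [[x y] /set_mem /= cK cmin] := compact_EVT_min D0 cD
  (continuous_subspaceT (@continuous_cmod_horner p)).
have {}cmin w : cmod w <= K -> cmod p.[mk (x, y)] <= cmod p.[w].
  by case: w => a b abK; apply: (cmin (a, b)); apply/mem_set.
apply: le_trans (cmin z zK); have : cmod (mk (x, y)) <= K := cK.
rewrite le_eqVlt => /orP[/eqP {}cK|{}cK].
  exact: mmin.
(* A step shorter than the distance to the circle stays in the disc, where it would beat the
   minimum. *)
have e0 : 0 < (K - cmod (mk (x, y)))%:C%C by rewrite ltcR subr_gt0.
have [h] := poly_descent _ _ _ _ sp (p0 _ cK) e0.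
rewrite !cmodE !ltcR => hK; rewrite ltNge cmin // (le_trans (ler_cmodD _ _)) //.
by rewrite -lerBrDl ltW.
Qed.

(* After squaring, the difference of the two sides is affine in the inner
   product of [u] and [w] with nonnegative slope, so the extremal position is
   [w] opposite to [u]. *)
Lemma cmod_ratio (r R K : F) u w : cmod u = 1 -> 0 < r -> r < R -> R <= K ->
  K <= cmod w ->
  cmod (R%:C%C * u - w) * (r + K) <= cmod (r%:C%C * u - w) * (R + K).
Proof.
case: u w => a b [x y] u1 r0 rR RK Kw.
have rho0 := cmod_ge0 (x +i* y)%C; set rho := cmod (x +i* y)%C in rho0 Kw.
have sqE (v v' : F) : cmod (v +i* v')%C ^+ 2 = v ^+ 2 + v' ^+ 2.
  by rewrite /cmod sqr_sqrtr // addr_ge0 // sqr_ge0.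
have rhoE : rho ^+ 2 = x ^+ 2 + y ^+ 2 by rewrite sqE.
have ab1 : a ^+ 2 + b ^+ 2 = 1 by rewrite -sqE u1 expr1n.
pose c := a * x + b * y.
(* Cauchy-Schwarz for the inner product [c], by Lagrange's identity. *)
have c_ge : 0 <= c + rho.
  rewrite -lerBlDr sub0r lerNl; apply: le_trans (ler_norm _) _; rewrite normrN.
  rewrite -ler_sqr ?nnegrE // real_normK ?num_real // rhoE -[leRHS]mul1r -ab1.
  by rewrite -subr_ge0 (_ : _ - _ = (a * y - b * x) ^+ 2) ?sqr_ge0 // /c; ring.
have K0 : 0 < K by lra.
have distE (t : F) : cmod (t%:C%C * (a +i* b)%C - (x +i* y)%C) ^+ 2 =
    t ^+ 2 + rho ^+ 2 - 2 * t * c.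
  have -> : (t%:C%C * (a +i* b)%C - (x +i* y)%C) = ((t * a - x) +i* (t * b - y))%C.
    by simpc.
  have t2 : t ^+ 2 = t ^+ 2 * (a ^+ 2 + b ^+ 2) by rewrite ab1 mulr1.
  by rewrite sqE rhoE t2 /c; ring.
rewrite -ler_sqr ?nnegrE ?mulr_ge0 ?cmod_ge0 //; try lra.
rewrite !exprMn !distE -subr_ge0.
(* The value at [c = - rho], a factored difference of squares, plus [c + rho] times the slope. *)
rewrite (_ : _ - _ = ((r + rho) * (R + K) - (R + rho) * (r + K)) *
    ((r + rho) * (R + K) + (R + rho) * (r + K)) +
    2 * (c + rho) * ((R - r) * (K ^+ 2 - r * R))); last by ring.
rewrite (_ : (r + rho) * (R + K) - (R + rho) * (r + K) =
    (R - r) * (rho - K)); last by ring.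
have rRK : r * R <= K ^+ 2 by rewrite expr2 ler_pM //; lra.
apply: addr_ge0; last by rewrite !mulr_ge0 ?subr_ge0 //; lra.
apply: mulr_ge0; first by rewrite mulr_ge0 ?subr_ge0 //; lra.
by apply: addr_ge0; apply: mulr_ge0; lra.
Qed.

(** Split [p] into linear factors: every root has modulus at least [K], so [cmod_ratio] applies to
    each, and the roots with multiplicity number [(size p).-1]. *)
Lemma horner_ratio (r R K : F) u p : cmod u = 1 -> 0 < r -> r < R -> R <= K ->
  (forall z, cmod z < K -> p.[z] != 0) ->
  cmod p.[R%:C%C * u] <= ((R + K) / (r + K)) ^+ (size p).-1 * cmod p.[r%:C%C * u].
Proof.
move=> u1 r0 rR RK p0; have [s sE] := closed_field_poly_normal p.
have [->|pn0] := eqVneq p 0; first by rewrite !horner0 cmod_real normr0 mulr0.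
have l0 : lead_coef p != 0 by rewrite lead_coef_eq0.
have -> : (size p).-1 = size s.
  by rewrite sE size_scale // size_prod_XsubC.
have sK w : w \in s -> K <= cmod w.
  move=> ws; rewrite leNgt; apply/negP => /p0; rewrite sE hornerZ mulf_eq0 negb_or.
  by rewrite -/(root _ _) root_prod_XsubC ws andbF.
rewrite sE !hornerZ !cmodM mulrCA ler_wpM2l ?cmod_ge0 //.
elim: s sK {sE} => [|w s IH] sK; first by rewrite !big_nil !hornerC mul1r.
rewrite !big_cons !hornerM !cmodM !hornerXsubC /= exprS mulrACA.
rewrite ler_pM ?cmod_ge0 //.
  rewrite mulrAC ler_pdivlMr; last by lra.
  by rewrite [leRHS]mulrC; apply: cmod_ratio => //; rewrite sK // mem_head.
by apply: IH => v vs; apply: sK; rewrite in_cons vs orbT.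
Qed.

(** Subtracting from [p] a constant of modulus below the minimum creates no zero in the disc, so
    [horner_ratio] still applies; the constant is aligned with [p.[v]] to make the right side as
    small as possible. *)
Lemma maxmod_minmod_ratio (n : nat) p (r R K : F) : (size p <= n.+1)%N ->
  0 < r -> r < R -> R <= K -> (forall z, cmod z < K -> p.[z] != 0) ->
  maxmod p R - minmod p K <= ((R + K) / (r + K)) ^+ n * (maxmod p r - minmod p K).
Proof.
move=> sp r0 rR RK p0; set x := (R + K) / (r + K); set m := minmod p K.
have R0 : 0 < R by lra.
have K0 : 0 < K by lra.
have x1 : 1 <= x by rewrite /x ler_pdivlMr ?mul1r ?lerD2r ?addr_gt0 // ltW.
have m0 : 0 <= m.
  by rewrite /m; have [[z _ <-] _] := minmodP p (ltW K0); exact: cmod_ge0.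
have [[z zR <-] _] := maxmodP p (ltW R0).
pose u := z / R%:C%C.
have RC0 : R%:C%C != 0 by rewrite -[0]/(0%:C)%C (inj_eq (@complexI _)) gt_eqF.
have zE : z = R%:C%C * u by rewrite /u mulrC divfK.
have u1 : cmod u = 1.
  apply: (mulfI (lt0r_neq0 R0)); rewrite mulr1 -[in RHS]zR zE cmodM cmod_real.
  by rewrite gtr0_norm.
set v := r%:C%C * u.
have vr : cmod v = r by rewrite /v cmodM cmod_real u1 mulr1 gtr0_norm.
have vM : cmod p.[v] <= maxmod p r by have [_] := maxmodP p (ltW r0); exact.
have vK : cmod v < K by lra.
have pv0 : 0 < cmod p.[v].
  rewrite lt0r cmod_ge0 andbT; apply: contra (p0 v vK) => /eqP pv.
  by apply/eqP; apply: ComplexField.Normc.eq0_normc.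
have mv : m <= cmod p.[v] by apply: minmod_principle => //; exact: ltW.
(* The alternative [t == 0] covers a vanishing minimum, where no [t < m] is available. *)
have key t : 0 <= t -> (t == 0) || (t < m) ->
    cmod p.[z] - t <= x ^+ n * (maxmod p r - t).
  move=> t0 tm.
  have tv : t <= cmod p.[v].
    by case/orP: tm => [/eqP ->|/ltW/le_trans]; [exact: ltW|exact].
  pose w := (t / cmod p.[v])%:C%C * p.[v].
  have wt : cmod w = t.
    by rewrite /w cmodM cmod_real ger0_norm ?divr_ge0 ?cmod_ge0 // divfK // gt_eqF.
  (* A zero [y] would give [|p.[y]| = t], against the minimum principle if [t < m] and against [p0]
     if [t = 0]. *)
  have q0 y : cmod y < K -> (p - w%:P).[y] != 0.
    move=> yK; rewrite hornerD hornerN hornerC subr_eq0.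
    apply: contraTneq tm => py; rewrite negb_or -leNgt -wt -py.
    rewrite minmod_principle ?ltW // andbT.
    by apply: contra (p0 y yK) => /eqP/ComplexField.Normc.eq0_normc ->.
  have sq : ((size (p - w%:P)%R).-1 <= n)%N.
    rewrite -subn1 leq_subLR add1n (leq_trans (size_polyD _ _)) //.
    by rewrite geq_max sp size_polyN (leq_trans (size_polyC_leq1 _)).
  have := horner_ratio _ _ _ _ _ u1 r0 rR RK q0.
  rewrite -zE -/v -/x !(hornerD, hornerN, hornerC).
  have -> : p.[v] - w = (1 - t / cmod p.[v])%:C%C * p.[v].
    by rewrite rmorphB mulrBl mul1r.
  rewrite [in leRHS]cmodM cmod_real ger0_norm; last first.
    by rewrite subr_ge0 ler_pdivrMr // mul1r.
  rewrite mulrBl mul1r divfK ?gt_eqF // => zw.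
  apply: (@le_trans _ _ (cmod (p.[z] - w))); first by rewrite -{1}wt ler_cmodB.
  apply: le_trans zw _.
  apply: ler_pM; rewrite ?exprn_ge0 ?subr_ge0 ?(le_trans ler01) //.
    exact: ler_weXn2l.
  exact: lerB.
move: m0; rewrite le_eqVlt => /orP[/eqP m0|m_gt0].
  by rewrite -m0; apply: key; rewrite ?eqxx.
set X := x ^+ n in key *; have X1 : 1 <= X by rewrite exprn_ege1.
(* Use [t = m - s]: the minimum keeps [t] nonnegative and the error [X * s] at most [e]. *)
apply/ler_addgt0Pr => e e0; pose s := Num.min m (e / X).
have s0 : 0 < s by rewrite lt_min m_gt0 divr_gt0 //; lra.
have sm : s <= m by rewrite ge_min lexx.
have sX : X * s <= e by rewrite mulrC -ler_pdivlMr ?ge_min ?lexx ?orbT //; lra.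
have : cmod p.[z] - (m - s) <= X * (maxmod p r - (m - s)).
  by apply: key; [lra|apply/orP; right; lra].
rewrite !mulrBr; lra.
Qed.

End Modulus.

(** * From the growth factor to the stated constant *)

Theorem theorem2p3 (F : realType) (n : nat) (p : {poly F[i]}) (K : F)
    (degp : size p = n.+1) (K_ge1 : 1 <= K)
    (p_neq0 : forall z : F[i], cmod z < K -> p.[z] != 0)
    (r R : F) (r_gt0 : 0 < r) (r_ltR : r < R) (R_le1 : R <= 1) :
  maxmod p r >=
    (1 + r) ^+ n / ((1 + r) ^+ n + (R + K) ^+ n - (r + K) ^+ n) *
    (maxmod p R + n%:R * minmod p K * ln ((R + K) / (r + K))).
Proof.
set m := minmod p K; set x := (R + K) / (r + K).
have R0 : 0 < R by lra.
have K0 : 0 < K by lra.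
have RK : R <= K by lra.
have m0 : 0 <= m.
  by rewrite /m; have [[z _ <-] _] := minmodP p (ltW K0); exact: cmod_ge0.
have M0 : 0 <= maxmod p r.
  by have [[z _ <-] _] := maxmodP p (ltW r_gt0); exact: cmod_ge0.
have x0 : 0 < x by rewrite divr_gt0 ?addr_gt0.
(* This is [ln (1 + y) <= y] at [y = x ^+ n - 1]. *)
have lnx : n%:R * ln x <= x ^+ n - 1.
  rewrite mulrC mulr_natr -lnXn // -[in leLHS](subrK 1 (x ^+ n)) addrC.
  by apply: le_ln1Dx; rewrite ltrBrDr addNr exprn_gt0.
have ratio : maxmod p R + n%:R * m * ln x <= x ^+ n * maxmod p r.
  have : maxmod p R - m <= x ^+ n * (maxmod p r - m).
    by apply: maxmod_minmod_ratio => //; rewrite degp.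
  have : m * (n%:R * ln x) <= m * (x ^+ n - 1) by rewrite ler_wpM2l.
  rewrite !mulrBr; lra.
set A := (1 + r) ^+ n; set C := (R + K) ^+ n; set B := (r + K) ^+ n.
have A0 : 0 < A by rewrite exprn_gt0 // addr_gt0.
(* Here [1 <= K] gives [1 + r <= r + K]. *)
have AB : A <= B by rewrite lerXn2r ?nnegrE //; lra.
have BC : B <= C by rewrite lerXn2r ?nnegrE //; lra.
have D0 : 0 < A + C - B by lra.
apply: (@le_trans _ _ (A / (A + C - B) * (x ^+ n * maxmod p r))).
  by rewrite ler_wpM2l // divr_ge0 //; exact: ltW.
rewrite mulrA ler_piMl // /x expr_div_n -/B -/C.
rewrite mulrAC ler_pdivrMr // mul1r mulrA ler_pdivrMr ?exprn_gt0 ?addr_gt0 //.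
(* Since [x ^+ n = C / B], the claim is [A * C <= B * (A + C - B)], whose two sides differ by
   exactly this product. *)
have : 0 <= (B - A) * (C - B) by rewrite mulr_ge0 ?subr_ge0.
lra.
Qed.
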